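(* Let $t$ be a fixed positive integer and let $\overline{\mathcal D}=(\overline X,\overline{\mathcal B},\overline\rho)$ be a $t$-$(\overline s,k,\overline\lambda_t)$-divisible design with the following properties: (i) $\overline X$ is a set of $\overline v$ points generating a finite projective space $\mathrm{PG}(d,q)$; (ii) all $\overline\rho$-transversal $t$-subsets of $\overline X$ are independent in $\mathrm{PG}(d,q)$; (iii) all blocks in $\overline{\mathcal B}$ span subspaces of $\mathrm{PG}(d,q)$ of the same dimension $\beta-1$. Then for each non-negative integer $c$ there exists a $t$-$(q^c\overline s,k,q^{c(\beta-t)}\overline\lambda_t)$-divisible design with $q^c\overline v$ points.
   Context: A $t$-$(s,k,\lambda_t)$-divisible design $(X,\mathcal B,\rho)$: $X$ finite, $\rho$ an equivalence relation (classes = point classes), a subset is $\rho$-transversal if it meets each class in at most one point; all blocks in $\mathcal B$ are $\rho$-transversal $k$-subsets of $X$, every class has size $s$, each $\rho$-transversal $t$-subset lies in exactly $\lambda_t$ blocks, and $t\le\#X/s$ (blocks are sets, no repetition). Points of $\mathrm{PG}(d,q)$ are independent if representing vectors in $\mathbb F_q^{d+1}$ are linearly independent. *)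

(* Defs.v *)
From HB Require Import structures.
From mathcomp Require Import all_boot all_order all_algebra.

Set Implicit Arguments.
Unset Strict Implicit.
Unset Printing Implicit Defensive.

Import GRing.Theory VectorInternalTheory.

(* The point set X is a subset of an ambient finType T, so that it may in
   particular be a set of points of a projective space. The relation rho is
   constrained, and used, on X only. *)
Section DivisibleDesign.

Variable T : finType.
Implicit Types (X Y b : {set T}) (B : {set {set T}}) (rho : rel T).

Definition point_class X rho (x : T) : {set T} := [set y in X | rho x y].

Definition rho_transversal X rho Y : bool :=
  (Y \subset X) && [forall x in X, #|Y :&: point_class X rho x| <= 1].

(* As all classes have s elements, s divides #|X|, hence #|X| %/ s is the exact
   quotient; it is 0 when s = 0. *)
Record divisible_design (t s k lam : nat) X B rho : Prop := DivisibleDesign {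
  dd_equiv : {in X & &, equivalence_rel rho};
  dd_block : forall b, b \in B -> rho_transversal X rho b /\ #|b| = k;
  dd_class : forall x, x \in X -> #|point_class X rho x| = s;
  dd_lambda : forall Y, rho_transversal X rho Y -> #|Y| = t ->
    #|[set b in B | Y \subset b]| = lam;
  dd_bound : t <= #|X| %/ s }.

End DivisibleDesign.

(* The points of PG(d, #|F|) are the one-dimensional subspaces of F^(d+1). *)
Record pg_point (F : finFieldType) (d : nat) := PGPoint {
  pg_line :> {vspace 'rV[F]_d.+1};
  dim_pg_line : \dim pg_line == 1 }.

Section ProjectiveSpace.

Variables (F : finFieldType) (d : nat).

HB.instance Definition _ := [isSub for @pg_line F d].
HB.instance Definition _ := [Choice of pg_point F d by <:].

Let pg_mx (P : pg_point F d) := vs2mx (pg_line P).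
Let mx_pg (A : 'M[F]_(dim 'rV[F]_d.+1)) : option (pg_point F d) :=
  insub (mx2vs A).

Fact pg_mxK : pcancel pg_mx mx_pg.
Proof. by move=> P; rewrite /mx_pg /pg_mx vs2mxK valK. Qed.

HB.instance Definition _ : isCountable (pg_point F d) := PCanIsCountable pg_mxK.
HB.instance Definition _ : isFinite (pg_point F d) :=
  PCanIsFinite pg_mxK.

Implicit Types (A : {set pg_point F d}) (P : pg_point F d).

Definition pg_span A : {vspace 'rV[F]_d.+1} := (\sum_(P in A) pg_line P)%VS.

Definition pg_generates A : Prop := pg_span A = fullv.

(* vpick P is a nonzero vector of the line P; linear independence of the
   representing vectors does not depend on this choice. *)
Definition pg_independent A : bool := free [seq vpick (pg_line P) | P <- enum A].

(* A projective subspace has dimension one less than the underlying vector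
   space; -1 is the dimension of the empty subspace. *)
Definition pg_dim (U : {vspace 'rV[F]_d.+1}) : int :=
  (Posz (\dim U) - 1)%R.

End ProjectiveSpace.

(* Main.v *)
Require Import Defs.
From mathcomp Require Import all_boot all_order all_algebra.

(* Put a copy of [F^c] over each point, so that the new points are the pairs
   (P, w) and the classes are pulled back along the first projection. The blocks
   are the graphs over [b \in B] of the linear maps [M] from the ambient space to
   [F^c], evaluated at representing vectors. A transversal t-set of new points
   is the graph of a function on an independent t-set [Y]; a block lying over
   [b] contains it iff [Y \subset b] and the linear map, which only matters on
   the beta-dimensional span of [b], takes t prescribed values at independent
   vectors. There are [q ^ (c * (beta - t))] such maps. *)

Set Implicit Arguments.
Unset Strict Implicit.
Unset Printing Implicit Defensive.

Import GRing.Theory.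

(** Points related to a common [x] are related to each other, so the bound on each class amounts to
    a pairwise condition, which passes easily through [fst]. *)
Lemma rho_transversalP (T : finType) (X Y : {set T}) (rho : rel T) :
  {in X & &, equivalence_rel rho} ->
  reflect (Y \subset X /\ {in Y &, forall y z, rho y z -> y = z})
          (rho_transversal X rho Y).
Proof.
move=> eqv; apply: (iffP andP) => [[sYX /forall_inP h]|[sYX h]]; split=> //.
  move=> y z yY zY ryz.
  have [yX zX] := (subsetP sYX _ yY, subsetP sYX _ zY).
  apply: (card_le1_eqP (h y yX)); rewrite !inE ?yY ?zY ?yX ?zX ?ryz //.
  by have [->] := eqv y y y yX yX yX.
apply/forall_inP => x xX; apply/card_le1_eqP => z y.
rewrite !inE => /and3P[zY zX rxz] /and3P[yY yX rxy].
by apply: h => //; have [_ /(_ rxy) <-] := eqv x y z xX yX zX.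
Qed.

Section LinearAlgebra.

Local Open Scope ring_scope.

Lemma row_free_matrix_of_free (F : fieldType) (n m : nat)
    (e : m.-tuple 'rV[F]_n) :
  free e -> row_free (\matrix_(i < m) e`_i).
Proof.
move/freeP => fe; rewrite -kermx_eq0; apply/eqP/row_matrixP => j; rewrite row0.
set w := row j _.
have : w *m (\matrix_(i < m) e`_i) = 0.
  by rewrite /w -row_mul mulmx_ker row0.
rewrite mulmx_sum_row => w0; apply/rowP => i; rewrite [RHS]mxE.
apply: (fe (fun i => w 0 i)); rewrite -[RHS]w0.
by apply: eq_bigr => l _; rewrite rowK.
Qed.

(** A right inverse of [C] makes [Z |-> C *m Z] onto, with fibers that are translates of one
    another; so the [#|F| ^ (c * n)] matrices split evenly over [#|F| ^ (c * m)] values. *)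
Lemma card_mulmx_fiber (F : finFieldType) (m n c : nat)
    (C : 'M[F]_(m, n)) (W : 'M[F]_(m, c)) :
  row_free C ->
  #|[set Z : 'M[F]_(n, c) | C *m Z == W]| = (#|F| ^ (c * (n - m)))%N.
Proof.
move=> fC.
have CV : C *m pinvmx C = 1%:M by rewrite mulmxVp.
have le_mn : (m <= n)%N by rewrite -(eqP fC) rank_leq_col.
have fib V : #|[set Z : 'M[F]_(n, c) | C *m Z == V]| =
             #|[set Z : 'M[F]_(n, c) | C *m Z == W]|.
  (* Translation by [pinvmx C *m (W - V)] carries the fiber over [V] onto the fiber over [W]. *)
  rewrite -(card_imset _ (addrI (pinvmx C *m (W - V)))).
  apply: eq_card => Z; rewrite !inE; apply/imsetP/eqP => [[Z' + ->]|CZ].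
    by rewrite inE mulmxDr mulmxA CV mul1mx => /eqP->; rewrite subrK.
  exists (Z - pinvmx C *m (W - V)); last by rewrite addrC subrK.
  by rewrite inE mulmxBr mulmxA CV mul1mx CZ opprB addrC subrK.
have F1 : (0 < #|F|)%N by apply/card_gt0P; exists 0.
apply/eqP; rewrite -(@eqn_pmul2l (#|F| ^ (c * m))%N) ?expn_gt0 ?F1 //.
rewrite -expnD -mulnDr subnKC // ![(c * _)%N]mulnC -!card_mx; apply/eqP.
rewrite -[RHS]sum1_card (partition_big (mulmx C) xpredT) //=.
rewrite (eq_bigr (fun=> #|[set Z : 'M[F]_(n, c) | C *m Z == W]|)).
  by rewrite sum_nat_const.
by move=> V _; rewrite -(fib V) -sum1_card; apply: eq_bigl => Z; rewrite !inE.
Qed.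

End LinearAlgebra.

Section LinearGraph.

Local Open Scope ring_scope.

Variables (F : finFieldType) (n c : nat) (T : finType) (u : T -> 'rV[F]_n).
Implicit Types (b : {set T}) (M : 'M[F]_(n, c)).

(** Matrices that agree on the span of the vectors [u x], [x] in [b], give the same set; hence
    graphs are counted below as sets, not by their matrices. *)
Definition linear_graph b M : {set T * 'rV[F]_c} :=
  [set (x, u x *m M) | x in b].

Lemma mem_linear_graph b M (y : T * 'rV[F]_c) :
  (y \in linear_graph b M) = (y.1 \in b) && (u y.1 *m M == y.2).
Proof.
apply/imsetP/andP => [[x xb ->] //=|[yb /eqP yM]].
by exists y.1 => //; rewrite yM -surjective_pairing.
Qed.

Lemma fst_linear_graph b M : fst @: linear_graph b M = b.
Proof. by rewrite -imset_comp (eq_imset (g := id)) ?imset_id. Qed.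

Lemma fst_linear_graph_inj b M : {in linear_graph b M &, injective fst}.
Proof.
move=> [x v] [y w]; rewrite !mem_linear_graph /=.
by move=> /andP[_ /eqP<-] /andP[_ /eqP<-] ->.
Qed.

Lemma card_linear_graph b M : #|linear_graph b M| = #|b|.
Proof. by rewrite card_imset // => x y []. Qed.

(** A graph over [b] amounts to the restriction of [M] to the span [U], that is, to a [\dim U] by
    [c] matrix [Z]. Containing [Y] becomes a linear system in [Z] with independent rows, whose
    solutions [card_mulmx_fiber] counts. *)
Lemma card_linear_graph_supset b (Y : {set T * 'rV[F]_c}) :
  fst @: Y \subset b -> free [seq u y.1 | y <- enum Y] ->
  #|[set linear_graph b M | M : 'M[F]_(n, c) & Y \subset linear_graph b M]| =
  (#|F| ^ (c * (\dim <<[seq u x | x <- enum b]>> - #|Y|)))%N.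
Proof.
move=> sYb fY; set U := (<<_>>)%VS.
pose G : 'M[F]_(\dim U, n) := \matrix_(i < \dim U) (vbasis U)`_i.
have fG : row_free G.
  by apply: row_free_matrix_of_free; exact: basis_free (vbasisP U).
have GV : G *m pinvmx G = 1%:M by rewrite mulmxVp.
have subG x : x \in b -> (u x <= G)%MS.
  move=> xb; have xU : u x \in U by rewrite memv_span // map_f ?mem_enum.
  rewrite (coord_vbasis xU); apply: summx_sub => i _; apply: scalemx_sub.
  by apply: submx_trans (row_sub i G); rewrite rowK.
have szY : size [seq u y.1 | y <- enum Y] == #|Y| by rewrite size_map cardE.
(* The rows of [A] are the vectors under [Y], those of [W] the prescribed values. *)
pose A : 'M[F]_(#|Y|, n) := \matrix_(i < #|Y|) (Tuple szY)`_i.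
have fA : row_free A by apply: row_free_matrix_of_free.
pose W : 'M[F]_(#|Y|, c) := \matrix_(i < #|Y|) (enum_val i).2.
have rowA i : row i A = u (enum_val i).1.
  have /card_gt0P[y0 _] : (0 < #|Y|)%N by apply: leq_ltn_trans (ltn_ord i).
  by rewrite rowK /= (nth_map y0) -?cardE // -enum_val_nth.
have rowb (i : 'I_#|Y|) : (enum_val i).1 \in b.
  by apply: (subsetP sYb); apply: imset_f; apply: enum_valP.
have AG : (A <= G)%MS.
  by apply/row_subP => i; rewrite rowA; apply/subG/rowb.
have subAW M : (Y \subset linear_graph b M) = (A *m M == W).
  apply/subsetP/eqP => [h|AW y yY].
    apply/row_matrixP => i; rewrite row_mul rowA rowK.
    have := h _ (enum_valP i).
    by rewrite mem_linear_graph => /andP[_ /eqP].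
  rewrite mem_linear_graph (subsetP sYb) ?imset_f //=.
  have := congr1 (row (enum_rank_in yY y)) AW.
  by rewrite row_mul rowA rowK enum_rankK_in // => ->.
(* This matrix holds the coordinates of the rows of [A] in the basis [G]; a right inverse [D] of [A]
   gives it the right inverse [G *m D]. *)
have fC : row_free (A *m pinvmx G).
  apply/row_freeP; have /row_freeP[D AD] := fA.
  by exists (G *m D); rewrite mulmxA mulmxKpV.
(* [pinvmx G *m Z] extends to the whole space the linear map on [U] with values [Z] on the basis
   [G]. *)
pose h (Z : 'M[F]_(\dim U, c)) := linear_graph b (pinvmx G *m Z).
have hG M : linear_graph b M = h (G *m M).
  apply: eq_in_imset => x xb; congr pair.
  by rewrite (mulmxA (pinvmx G)) mulmxA (mulmxA (u x)) mulmxKpV ?subG.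
have h_inj : injective h.
  move=> Z1 Z2 eqh; apply/eqP; rewrite -subr_eq0.
  pose D := pinvmx G *m (Z1 - Z2).
  have -> : Z1 - Z2 = G *m D by rewrite /D mulmxA GV mul1mx.
  (* Equality of the graphs makes [f] vanish at each [u x], hence on [U] and on its basis, so
     [G *m D = 0]. *)
  pose f := linfun (mulmxr D : 'rV[F]_n -> 'rV[F]_c).
  have sU : (U <= lker f)%VS.
    apply/span_subvP => _ /mapP[x xb ->]; rewrite mem_enum in xb.
    rewrite memv_ker lfunE /= /D mulmxBr mulmxBr subr_eq0.
    have : (x, u x *m (pinvmx G *m Z1)) \in h Z2.
      by rewrite -eqh mem_linear_graph /= xb eqxx.
    by rewrite mem_linear_graph /= eq_sym => /andP[].
  apply/eqP/row_matrixP => i; rewrite row_mul rowK row0.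
  have : (vbasis U)`_i \in lker f.
    by apply: (subvP sU); rewrite vbasis_mem ?mem_nth ?size_tuple.
  by rewrite memv_ker lfunE /= => /eqP.
rewrite -(card_mulmx_fiber W fC) -(card_imset _ h_inj).
apply: eq_card => b'; apply/imsetP/imsetP => [[M + ->]|[Z + ->]]; rewrite inE.
  rewrite subAW => AW; exists (G *m M); last exact: hG.
  by rewrite inE mulmxA mulmxKpV.
move=> CZ; exists (pinvmx G *m Z) => //.
by rewrite inE subAW mulmxA.
Qed.

End LinearGraph.

Section Lift.

Variables (F : finFieldType) (n c : nat) (T : finType) (u : T -> 'rV[F]_n).
Variables (t s k lam beta : nat) (X : {set T}) (B : {set {set T}}).
Variable rho : rel T.

(** The projective points enter only through representing vectors, so any map [u] into a vector
    space will do. *)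
Lemma divisible_design_lift :
  0 < t -> divisible_design t s k lam X B rho ->
  (forall Y : {set T}, rho_transversal X rho Y -> #|Y| = t ->
     free [seq u x | x <- enum Y]) ->
  (forall b : {set T}, b \in B -> \dim <<[seq u x | x <- enum b]>> = beta) ->
  divisible_design t (#|F| ^ c * s) k (#|F| ^ (c * (beta - t)) * lam)
    (setX X [set: 'rV[F]_c])
    [set linear_graph u b M | b in B, M in [set: 'M[F]_(n, c)]]
    (fun x y => rho x.1 y.1).
Proof.
move=> t0 [eqv dblock dclass dlambda dbound] hind hdim.
have F0 : 0 < #|F| by apply/card_gt0P; exists 0%R.
have eqv' : {in setX X [set: 'rV[F]_c] & &,
    equivalence_rel (fun x y => rho x.1 y.1)}.
  move=> x y z; rewrite !inE !andbT => xX yX zX.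
  by have := eqv _ _ _ xX yX zX.
split=> //.
- move=> _ /imset2P[b M bB _ ->]; have [tb kb] := dblock _ bB.
  rewrite card_linear_graph kb; split=> //.
  have /(rho_transversalP _ eqv)[sbX inj_b] := tb.
  apply/(rho_transversalP _ eqv'); split.
    apply/subsetP => y; rewrite mem_linear_graph !inE andbT => /andP[yb _].
    exact: (subsetP sbX).
  move=> y z yM zM ryz; apply: (fst_linear_graph_inj yM zM).
  by move: yM zM; rewrite !mem_linear_graph => /andP[yb _] /andP[zb _]; apply: inj_b.
(* The class of [(x, v)] is the class of [x] times the whole of [F^c]. *)
- move=> [x v]; rewrite !inE andbT /= => xX.
  rewrite -(dclass _ xX) mulnC -[c in #|F| ^ c]mul1n -card_mx -cardsT -cardsX.
  by apply: eq_card => -[y w]; rewrite !inE /= !andbT.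
- move=> Y /(rho_transversalP _ eqv')[sYX injY] cY.
  have subX y : y \in Y -> y.1 \in X.
    by move=> /(subsetP sYX); rewrite !inE andbT.
  have fst_inj : {in Y &, injective fst}.
    move=> y z yY zY yz; apply: injY => //; rewrite yz.
    by have zX := subX _ zY; have [->] := eqv _ _ _ zX zX zX.
  have tY : rho_transversal X rho (fst @: Y).
    apply/(rho_transversalP _ eqv); split.
      by apply/subsetP => _ /imsetP[y yY ->]; exact: subX.
    by move=> _ _ /imsetP[y yY ->] /imsetP[z zY ->] /(injY _ _ yY zY) ->.
  have cfY : #|fst @: Y| = t by rewrite card_in_imset.
  have fY : free [seq u y.1 | y <- enum Y].
    rewrite map_comp (perm_free (_ : perm_eq _ [seq u x | x <- enum (fst @: Y)])).
      exact: hind.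
    apply/perm_map/uniq_perm; rewrite ?enum_uniq ?map_inj_in_uniq ?enum_uniq //.
      by move=> y z; rewrite !mem_enum; exact: fst_inj.
    move=> x; rewrite mem_enum; apply/mapP/imsetP => -[y yY ->]; exists y => //.
      by rewrite -mem_enum.
    by rewrite mem_enum.
  (* Sort the blocks through [Y] by their projection [b]: there are [lam] choices of [b], each with
     equally many blocks above it. *)
  rewrite -sum1_card (partition_big (fun b : {set _} => fst @: b)
    [in [set b in B | fst @: Y \subset b]]) /=; last first.
    move=> b'; rewrite inE => /andP[/imset2P[b M bB _ ->] sY].
    by rewrite inE fst_linear_graph bB -(fst_linear_graph u b M) imsetS.
  rewrite (eq_bigr (fun=> #|F| ^ (c * (beta - t)))).
    by rewrite sum_nat_const dlambda // mulnC.
  (* The truncated [beta - t] is exact here: [b] contains the [t] independent points of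
     [fst @: Y]. *)
  move=> b; rewrite inE => /andP[bB sYb].
  rewrite -(hdim b bB) -cY -(card_linear_graph_supset sYb fY) -sum1_card.
  apply: eq_bigl => b'; rewrite !inE.
  apply/andP/imsetP => [[/andP[/imset2P[b1 M _ _ ->] sY]]|[M + ->]].
    by rewrite fst_linear_graph => /eqP eb; exists M; rewrite ?inE -eb.
  by rewrite inE fst_linear_graph eqxx => ->; rewrite imset2_f ?inE.
(* The factor [#|F| ^ c] cancels, so the number of classes is unchanged. *)
- by rewrite cardsX cardsT card_mx mul1n mulnC divnMl // expn_gt0 F0.
Qed.

End Lift.

Lemma pg_line_vpick (F : finFieldType) (d : nat) (P : pg_point F d) :
  pg_line P = <[vpick (pg_line P)]>%VS.
Proof.
apply/esym/eqP; rewrite eqEdim -memvE memv_pick (eqP (dim_pg_line P)).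
by rewrite dim_vline vpick0 -dimv_eq0 (eqP (dim_pg_line P)).
Qed.

Lemma pg_span_vpick (F : finFieldType) (d : nat) (A : {set pg_point F d}) :
  pg_span A = <<[seq vpick (pg_line P) | P <- enum A]>>%VS.
Proof.
rewrite span_def big_map big_enum.
by apply: eq_bigr => P _; exact: pg_line_vpick.
Qed.

Theorem theorem3p1 (t : nat) (ht : 0 < t)
    (F : finFieldType) (q : nat) (hq : #|F| = q) (d : nat)
    (s k lam v beta : nat)
    (X : {set pg_point F d}) (B : {set {set pg_point F d}})
    (rho : rel (pg_point F d))
    (hD : divisible_design t s k lam X B rho)
    (hv : #|X| = v)
    (hgen : pg_generates X)
    (hind : forall Y : {set pg_point F d},
       rho_transversal X rho Y -> #|Y| = t -> pg_independent Y)
    (hdim : forall b : {set pg_point F d},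
       b \in B -> pg_dim (pg_span b) = (Posz beta - 1)%R)
    (c : nat) :
  exists (T : finType) (X' : {set T}) (B' : {set {set T}}) (rho' : rel T),
    divisible_design t (q ^ c * s) k (q ^ (c * (beta - t)) * lam) X' B' rho'
    /\ #|X'| = q ^ c * v.
Proof.
have dim_b b : b \in B ->
    \dim <<[seq vpick (pg_line P) | P <- enum b]>> = beta.
  by move=> /hdim; rewrite pg_span_vpick => /addIr[].
subst q v; do 4 eexists; split.
  (* Here [u P] is [vpick (pg_line P)], read off from the unfolded [pg_independent]. *)
  exact: divisible_design_lift ht hD hind dim_b.
by rewrite cardsX cardsT card_mx mul1n mulnC.
Qed.
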